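(* Let $L_n$ be the number of leaves of the $2$-$3$-tree (the $B$-tree of order $3$, i.e. $m=1$) obtained by inserting the keys $\pi(1),\dots,\pi(n)$ successively into an empty tree, where $\pi$ is a uniformly random permutation in $S_n$. Then for $n>11$, \[ \mathbb E(L_n)=\tfrac37(n+1),\qquad \mathbb V(L_n)=\tfrac{12}{637}(n+1), \] and \[ \frac{L_n-\mathbb E(L_n)}{\sqrt{\mathbb V(L_n)}}\xrightarrow{d} N(0,1)\quad (n\to\infty). \]
   Context: A $B$-tree of order $2m+1$ is a rooted plane search tree whose nodes contain pairwise distinct keys in increasing left-to-right order (a non-leaf node with $k$ keys has $k+1$ children), every non-root node has between $m$ and $2m$ keys, the root between $1$ and $2m$, and all leaves have equal depth. Insertion: place the new key in the appropriate leaf; whenever a node has $2m+1$ keys, split it, moving the median key up into the parent and forming two nodes from the $m$ smallest and the $m$ largest keys (creating a new one-key root if the root splits). For $m=1$ these are $2$-$3$-trees. *)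

(* Defs.v *)
From HB Require Import structures.
From mathcomp Require Import all_boot all_order all_algebra all_fingroup.
From mathcomp Require Import all_classical all_reals all_analysis.
Set Implicit Arguments. Unset Strict Implicit. Unset Printing Implicit Defensive.
Import Order.TTheory GRing.Theory Num.Theory.

(* A node: its sorted key list and its list of children (empty for a leaf). *)
Inductive btree := BNode of seq nat & seq btree.

(* Result of inserting into a subtree: either the updated subtree, or the
   subtree overflowed and was split into (left, median key, right). *)
Inductive ins_result :=
  | Ok of btree
  | Split of btree & nat & btree.

Definition ins_key (x : nat) (ks : seq nat) : seq nat :=
  let i := count (fun k => k < x) ks in take i ks ++ x :: drop i ks.

Definition mk_node (m : nat) (ks : seq nat) (cs : seq btree) : ins_result :=
  if size ks <= 2 * m then Ok (BNode ks cs)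
  else Split (BNode (take m ks) (take m.+1 cs)) (nth 0 ks m)
             (BNode (drop m.+1 ks) (drop m.+1 cs)).

(* Insertion of x into a (nonempty) subtree.  In an internal node the key goes
   into child number i = #{keys < x}.  (The recursive results for all children
   are computed via [map] only to make the recursion structural; only the i-th
   is used.) *)
Fixpoint ins (m x : nat) (t : btree) : ins_result :=
  let: BNode ks cs := t in
  if cs is [::] then mk_node m (ins_key x ks) [::]
  else
    let i := count (fun k => k < x) ks in
    match nth (Ok t) (map (ins m x) cs) i with
    | Ok c => Ok (BNode ks (set_nth c cs i c))
    | Split l k r =>
        mk_node m (take i ks ++ k :: drop i ks) (take i cs ++ l :: r :: drop i.+1 cs)
    end.

Definition btree_insert (m x : nat) (t : option btree) : option btree :=
  match t with
  | None => Some (BNode [:: x] [::])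
  | Some t0 =>
      match ins m x t0 with
      | Ok t1 => Some t1
      | Split l k r => Some (BNode [:: k] [:: l; r])
      end
  end.

Definition btree_of_seq (m : nat) (s : seq nat) : option btree :=
  foldl (fun t x => btree_insert m x t) None s.

Fixpoint bleaves (t : btree) : nat :=
  let: BNode _ cs := t in
  if cs is [::] then 1 else sumn (map bleaves cs).

Definition leaves (t : option btree) : nat :=
  if t is Some t0 then bleaves t0 else 0.

(* Keys pi(1), ..., pi(n) for pi in S_n (realized on {0,...,n-1}; only the
   relative order of the keys matters for the tree shape). *)
Definition perm_keys (n : nat) (pi : 'S_n) : seq nat :=
  [seq (nat_of_ord (pi i)) | i <- enum 'I_n].

Definition Ln (n : nat) (pi : 'S_n) : nat :=
  leaves (btree_of_seq 1 (perm_keys pi)).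

Local Open Scope ring_scope.

Definition ELn (R : realType) (n : nat) : R :=
  (\sum_(pi : 'S_n) (Ln pi)%:R) / (n`!)%:R.

Definition VLn (R : realType) (n : nat) : R :=
  (\sum_(pi : 'S_n) ((Ln pi)%:R - ELn R n) ^+ 2) / (n`!)%:R.

Definition cdf_normalized_Ln (R : realType) (n : nat) (x : R) : R :=
  #|[set pi : 'S_n | ((Ln pi)%:R - ELn R n) / Num.sqrt (VLn R n) <= x]|%:R
    / (n`!)%:R.

(* Main.v *)
(* Reading the numbers of keys of the leaves from left to right, a new key whose
   rank is uniform among the n + 1 gaps adds a leaf iff it falls into a full leaf.
   Gaps and leaves determine the number of full leaves, so L_n is a Markov chain:
   L_{n+1} = L_n + 1 with probability 3 - 6 L_n / (n + 1).  The first two moments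
   satisfy linear recurrences whose homogeneous coefficients 1 - 6 / (n + 1) and
   1 - 12 / (n + 1) vanish at n = 5 and n = 11, which makes them explicit.

   With a_n proportional to n (n - 1) ... (n - 5), M_n = a_n (L_n - E L_n) is a
   martingale with centred Bernoulli increments.  Normalise it so that Var M_N = 1
   and put v_n = 1 + e^2 - Var M_n.  Since Phi ((t - y) / sqrt v) solves the heat
   equation, the mean of Phi ((t - M_n) / sqrt v_n) changes by O(N^(-3/2)) at each
   step.  It equals Phi (t / sqrt (1 + e^2)) at n = 5, where a_5 = 0, and the mean
   of Phi ((t - M_N) / e) at n = N; letting e -> 0 gives the limit law. *)

Require Import Defs.
From HB Require Import structures.
From mathcomp Require Import all_boot all_order all_algebra all_fingroup.
From mathcomp Require Import all_classical all_reals all_analysis.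
From mathcomp Require Import ring lra zify.
Import Order.TTheory GRing.Theory Num.Theory.
Set Implicit Arguments.
Unset Strict Implicit.

(** * The leaf profile of a 2-3-tree *)

(* A profile lists the numbers of keys of the leaves from left to right; a leaf
   with [s] keys owns [s.+1] consecutive gaps, and gaps are numbered from 0. *)
Fixpoint profile_insert (g : nat) (l : seq nat) : seq nat :=
  if l is s :: l' then
    if g <= s then if s == 1 then 2 :: l' else [:: 1, 1 & l']
    else s :: profile_insert (g - s.+1) l'
  else [:: 1].

Definition gaps (l : seq nat) : nat := sumn (map S l).

Definition rank (x : nat) (s : seq nat) : nat := count (fun k => k < x) s.

(* In [tree23 t i l], [i] is the sorted list of all keys of [t] and [l] its profile. *)
Inductive tree23 : btree -> seq nat -> seq nat -> Prop :=
| Tree23_leaf1 k : tree23 (BNode [:: k] [::]) [:: k] [:: 1]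
| Tree23_leaf2 k1 k2 : tree23 (BNode [:: k1; k2] [::]) [:: k1; k2] [:: 2]
| Tree23_node2 k t0 t1 i0 i1 l0 l1 :
    tree23 t0 i0 l0 -> tree23 t1 i1 l1 ->
    tree23 (BNode [:: k] [:: t0; t1]) (i0 ++ k :: i1) (l0 ++ l1)
| Tree23_node3 k1 k2 t0 t1 t2 i0 i1 i2 l0 l1 l2 :
    tree23 t0 i0 l0 -> tree23 t1 i1 l1 -> tree23 t2 i2 l2 ->
    tree23 (BNode [:: k1; k2] [:: t0; t1; t2])
      (i0 ++ k1 :: i1 ++ k2 :: i2) (l0 ++ l1 ++ l2).

(** Splitting keeps the overall sequence of keys and of leaves, so both outcomes are described by
    the same [i] and [l], cut at the median in the second case. *)
Definition result23 (r : ins_result) (i l : seq nat) : Prop :=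
  match r with
  | Ok t => tree23 t i l
  | Defs.Split t0 k t1 => exists i0 i1 l0 l1,
      [/\ tree23 t0 i0 l0, tree23 t1 i1 l1, i = i0 ++ k :: i1 & l = l0 ++ l1]
  end.

Lemma gaps_cat l0 l1 : gaps (l0 ++ l1) = gaps l0 + gaps l1.
Proof. by rewrite /gaps map_cat sumn_cat. Qed.

(** Each gap lies in exactly one leaf: an inner key is the border between two neighbouring
    leaves. *)
Lemma tree23_gaps t i l : tree23 t i l -> gaps l = (size i).+1.
Proof.
elim=> {t i l} //=.
  by move=> k t0 t1 i0 i1 l0 l1 _ h0 _ h1; rewrite gaps_cat size_cat /=; lia.
move=> k1 k2 t0 t1 t2 i0 i1 i2 l0 l1 l2 _ h0 _ h1 _ h2.
by rewrite !gaps_cat !size_cat /= size_cat /=; lia.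
Qed.

Lemma tree23_profile t i l : tree23 t i l -> all (fun s => (s == 1) || (s == 2)) l.
Proof.
elim=> {t i l} //=.
  by move=> k t0 t1 i0 i1 l0 l1 _ h0 _ h1; rewrite all_cat h0.
by move=> k1 k2 t0 t1 t2 i0 i1 i2 l0 l1 l2 _ h0 _ h1 _ h2; rewrite !all_cat h0 h1.
Qed.

Lemma tree23_leaves t i l : tree23 t i l -> bleaves t = size l.
Proof.
elim=> {t i l} //=.
  by move=> k t0 t1 i0 i1 l0 l1 _ -> _ ->; rewrite size_cat addn0.
by move=> k1 k2 t0 t1 t2 i0 i1 i2 l0 l1 l2 _ -> _ -> _ ->; rewrite !size_cat addn0.
Qed.

Lemma profile_insert_catl g l0 l1 :
  g < gaps l0 -> profile_insert g (l0 ++ l1) = profile_insert g l0 ++ l1.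
Proof.
elim: l0 g => [|s l0 IH] g; first by rewrite /gaps.
rewrite /gaps /= -/(gaps l0) => h; case: ifP => gs; first by case: ifP.
by rewrite IH //; lia.
Qed.

Lemma profile_insert_catr g l0 l1 :
  profile_insert (gaps l0 + g) (l0 ++ l1) = l0 ++ profile_insert g l1.
Proof.
elim: l0 => [|s l0 IH]; first by [].
rewrite /gaps /= -/(gaps l0); case: ifP => gs; first by lia.
by rewrite (_ : _ - _ = gaps l0 + g) ?IH //; lia.
Qed.

Lemma ins_key_catl x i0 k i1 : rank x i0 < (size i0).+1 -> ~~ (k < x) -> rank x i1 = 0 ->
  ins_key x (i0 ++ k :: i1) = ins_key x i0 ++ k :: i1.
Proof.
rewrite /ins_key /rank count_cat /= => h0 /negbTE -> ->; rewrite !addn0.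
rewrite take_cat drop_cat; case: ltnP => h1.
  by rewrite -catA.
have -> : count (fun k => k < x) i0 = size i0 by lia.
by rewrite subnn take0 drop0 cats0 take_size drop_size cats1 -cats1 -catA.
Qed.

Lemma ins_key_catr x i0 k i1 : k < x -> rank x i0 = size i0 ->
  ins_key x (i0 ++ k :: i1) = i0 ++ k :: ins_key x i1.
Proof.
rewrite /ins_key /rank count_cat /= => -> ->.
rewrite take_cat drop_cat ltnNge leq_addr /= addKn add1n /=.
by rewrite -catA.
Qed.

Lemma rank_lt x i : rank x i < (size i).+1.
Proof. by rewrite ltnS count_size. Qed.

Lemma sorted_cat_pivot i0 k i1 : sorted ltn (i0 ++ k :: i1) ->
  [/\ sorted ltn i0, sorted ltn i1, all (fun j => j < k) i0 & all (fun j => k < j) i1].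
Proof.
rewrite !(sorted_pairwise ltn_trans) pairwise_cat pairwise_cons allrel_consr.
by case/and3P => /andP[a0 _] p0 /andP[a1 p1].
Qed.

Lemma rank_all x k s : k <= x -> all (fun j => j < k) s -> rank x s = size s.
Proof.
move=> kx h; apply/eqP; rewrite -all_count; apply: sub_all h => j /=.
by move=> /leq_trans; apply.
Qed.

Lemma rank_none x k s : ~~ (k < x) -> all (fun j => k < j) s -> rank x s = 0.
Proof.
move=> kx h; apply/eqP; rewrite -leqn0 leqNgt -has_count -all_predC.
by apply: sub_all h => j /=; lia.
Qed.

(** The rank of [x] is the number of gaps left of the child it descends to plus its rank in that
    child, so the leaf reached owns gap [rank x i]. Splits of inner nodes only regroup subtrees. *)
Lemma ins_tree23 x t i l : tree23 t i l -> sorted ltn i ->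
  result23 (ins 1 x t) (ins_key x i) (profile_insert (rank x i) l).
Proof.
elim=> {t i l}.
- move=> k _; rewrite /= /mk_node /ins_key /rank /= !addn0.
  by case: (k < x) => /=; constructor.
- move=> k1 k2; rewrite /= /mk_node /ins_key /rank /= andbT addn0 => h.
  (* A full leaf splits into two one-key leaves for each of the three positions of [x]; the fourth
     combination contradicts [k1 < k2]. *)
  case: (ltnP k1 x) => h1; case: (ltnP k2 x) => h2 /=; try lia.
  + by exists [:: k1], [:: x], [:: 1], [:: 1]; split => //; constructor.
  + by exists [:: k1], [:: k2], [:: 1], [:: 1]; split => //; constructor.
  + by exists [:: x], [:: k2], [:: 1], [:: 1]; split => //; constructor.
- move=> k t0 t1 i0 i1 l0 l1 T0 IH0 T1 IH1 /sorted_cat_pivot[s0 s1 a0 a1].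
  have g0 := tree23_gaps T0.
  case: (ltnP k x) => hk.
    have r0 := rank_all (ltnW hk) a0.
    rewrite ins_key_catr // /rank count_cat -!/(rank _ _) /= hk r0.
    (* The [size i0] keys on the left and the pivot [k] together make up [gaps l0]. *)
    rewrite (_ : size i0 + (1 + rank x i1) = gaps l0 + rank x i1); last by lia.
    rewrite profile_insert_catr /=.
    have := IH1 s1; case: (ins 1 x t1) => [c|c k' c'] /= R1; first by constructor.
    case: R1 => [j0 [j1 [m0 [m1 [U0 U1 -> ->]]]]].
    by rewrite /mk_node /=; constructor.
  have {}hk : ~~ (k < x) by rewrite -leqNgt.
  have r1 := rank_none hk a1.
  rewrite ins_key_catl // ?rank_lt // /rank count_cat -!/(rank _ _) /= (negbTE hk) r1 !addn0.
  rewrite profile_insert_catl ?g0 ?rank_lt //=.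
  have := IH0 s0; case: (ins 1 x t0) => [c|c k' c'] /= R1; first by constructor.
  case: R1 => [j0 [j1 [m0 [m1 [U0 U1 -> ->]]]]].
  by rewrite /mk_node /= -!catA; constructor.
- move=> k1 k2 t0 t1 t2 i0 i1 i2 l0 l1 l2 T0 IH0 T1 IH1 T2 IH2.
  move=> /sorted_cat_pivot[s0 + a0 +] => /sorted_cat_pivot[s1 s2 a1 a2].
  rewrite all_cat /= => /and3P[b1 k12 b2].
  have g0 := tree23_gaps T0; have g1 := tree23_gaps T1.
  case: (ltnP k2 x) => hk2.
    have hk1 : k1 < x by lia.
    have r0 := rank_all (ltnW hk1) a0; have r1 := rank_all (ltnW hk2) a1.
    rewrite !ins_key_catr // /rank count_cat /= count_cat -!/(rank _ _) /= hk1 hk2 r0 r1.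
    rewrite (_ : size i0 + _ = gaps l0 + (gaps l1 + rank x i2)); last by lia.
    rewrite !profile_insert_catr /=.
    have := IH2 s2; case: (ins 1 x t2) => [c|c k' c'] /= R1; first by constructor.
    case: R1 => [j0 [j1 [m0 [m1 [U0 U1 -> ->]]]]].
    (* Three keys and four subtrees: the median [k2] moves up and each half keeps two subtrees. *)
    rewrite /mk_node /=; exists (i0 ++ k1 :: i1), (j0 ++ k' :: j1), (l0 ++ l1), (m0 ++ m1).
    by rewrite -!catA; split => //; constructor.
  have {}hk2 : ~~ (k2 < x) by rewrite -leqNgt.
  have r2 := rank_none hk2 a2.
  case: (ltnP k1 x) => hk1.
    have r0 := rank_all (ltnW hk1) a0.
    rewrite ins_key_catr // ins_key_catl // ?rank_lt //.
    rewrite /rank count_cat /= count_cat -!/(rank _ _) /= hk1 (negbTE hk2) r0 r2 !addn0.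
    rewrite (_ : size i0 + _ = gaps l0 + rank x i1); last by lia.
    rewrite profile_insert_catr profile_insert_catl ?g1 ?rank_lt //=.
    have := IH1 s1; case: (ins 1 x t1) => [c|c k' c'] /= R1; first by constructor.
    case: R1 => [j0 [j1 [m0 [m1 [U0 U1 -> ->]]]]].
    rewrite /mk_node /=; exists (i0 ++ k1 :: j0), (j1 ++ k2 :: i2), (l0 ++ m0), (m1 ++ l2).
    by rewrite -!catA; split => //; constructor.
  have {}hk1 : ~~ (k1 < x) by rewrite -leqNgt.
  have r1 := rank_none hk1 b1.
  rewrite ins_key_catl // ?rank_lt //; last first.
    by rewrite /rank count_cat /= -!/(rank _ _) r1 (negbTE hk2) r2.
  rewrite /rank count_cat /= count_cat -!/(rank _ _) /= (negbTE hk1) (negbTE hk2) r1 r2 !addn0.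
  rewrite profile_insert_catl ?g0 ?rank_lt //=.
  have := IH0 s0; case: (ins 1 x t0) => [c|c k' c'] /= R1; first by constructor.
  case: R1 => [j0 [j1 [m0 [m1 [U0 U1 -> ->]]]]].
  rewrite /mk_node /=; exists (j0 ++ k' :: j1), (i1 ++ k2 :: i2), (m0 ++ m1), (l1 ++ l2).
  by rewrite -!catA; split => //; constructor.
Qed.

(* [r] lists the inserted keys, latest first. *)
Fixpoint rev_profile (r : seq nat) : seq nat :=
  if r is x :: r' then profile_insert (rank x r') (rev_profile r') else [::].

(** Only the relative order of the keys matters; [f] will be [bump r], which makes room for a new
    key. *)
Lemma rev_profile_map (f : nat -> nat) r :
  {mono f : x y / x < y} -> rev_profile (map f r) = rev_profile r.
Proof.
move=> fm; elim: r => //= x r ->; congr profile_insert.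
by rewrite /rank count_map; apply: eq_count => k /=; rewrite fm.
Qed.

Lemma perm_ins_key x i : perm_eq (ins_key x i) (x :: i).
Proof. by rewrite /ins_key perm_catC /= perm_cons perm_catC cat_take_drop. Qed.

Lemma sorted_ins_key x i : sorted ltn i -> x \notin i -> sorted ltn (ins_key x i).
Proof.
elim: i => [|k i IH] //=; rewrite (path_sortedE ltn_trans) inE negb_or.
move=> /andP[ki si] /andP[xk xi].
case: (ltnP k x) => kx.
  have -> : ins_key x (k :: i) = k :: ins_key x i by rewrite /ins_key /= kx.
  rewrite /= (path_sortedE ltn_trans) IH // (perm_all _ (perm_ins_key x i)) /= kx.
  by rewrite ki.
have -> : ins_key x (k :: i) = [:: x, k & i].
  rewrite /ins_key /= -/(rank x i) (rank_none _ ki) -?leqNgt //.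
  by rewrite ltnNge kx.
by rewrite /= (path_sortedE ltn_trans) ki si !andbT; lia.
Qed.

Lemma btree_of_seq_tree23 s : uniq s -> s != [::] ->
  exists t i, [/\ btree_of_seq 1 s = Some t, sorted ltn i, perm_eq i s
                & tree23 t i (rev_profile (rev s))].
Proof.
elim/last_ind: s => // s x IH; rewrite rcons_uniq => /andP[xs us] _.
rewrite /btree_of_seq -cats1 foldl_cat -/(btree_of_seq 1 s) cats1 rev_rcons /=.
have [->|s0] := eqVneq s [::].
  by exists (BNode [:: x] [::]), [:: x]; split => //; constructor.
have [t [i [-> si pis T]]] := IH us s0.
have R1 := ins_tree23 x T si.
(* A rank is a count, hence the same for the sorted keys as for the keys in order of insertion. *)
rewrite (_ : rank x i = rank x (rev s)) in R1; last first.
  by rewrite /rank count_rev; exact/seq.permP.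
have sx : sorted ltn (ins_key x i) by apply: sorted_ins_key; rewrite ?(perm_mem pis).
have px : perm_eq (ins_key x i) (rcons s x).
  by rewrite (perm_trans (perm_ins_key x i)) // perm_sym perm_rcons perm_cons perm_sym.
rewrite /=; case: (ins 1 x t) R1 => [t'|t0 k t1] /= R1; first by exists t', (ins_key x i).
case: R1 => [j0 [j1 [m0 [m1 [U0 U1 e ->]]]]].
exists (BNode [:: k] [:: t0; t1]), (ins_key x i); split => //.
by rewrite e; constructor.
Qed.

(** * Uniform permutations, built by appending a last value *)

Lemma perm_keys_uniq n (pi : 'S_n) : uniq (perm_keys pi).
Proof. by rewrite map_inj_uniq ?enum_uniq // => i j /val_inj /perm_inj. Qed.

Lemma size_perm_keys n (pi : 'S_n) : size (perm_keys pi) = n.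
Proof. by rewrite size_map size_enum_ord. Qed.

Definition perm_profile n (pi : 'S_n) := rev_profile (rev (perm_keys pi)).

Lemma perm_profileP n (pi : 'S_n.+1) :
  [/\ Ln pi = size (perm_profile pi), gaps (perm_profile pi) = n.+2
    & all (fun s => (s == 1) || (s == 2)) (perm_profile pi)].
Proof.
have [|t [i [h si pis T]]] := btree_of_seq_tree23 (perm_keys_uniq pi).
  by rewrite -size_eq0 size_perm_keys.
rewrite /Ln h /= (tree23_leaves T) (tree23_gaps T) (tree23_profile T).
by rewrite (perm_size pis) size_perm_keys.
Qed.

(** A permutation amounts to its last value [r] and the pattern [s] of the values before it. *)
Lemma perm_keys_lift n (r : 'I_n.+1) (s : 'S_n) :
  perm_keys (lift_perm ord_max r s) = rcons (map (bump r) (perm_keys s)) r.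
Proof.
rewrite /perm_keys enum_ordSr map_rcons lift_perm_id; congr rcons.
rewrite -!map_comp; apply: eq_map => i /=.
rewrite (_ : widen_ord _ i = lift ord_max i) ?lift_perm_lift //.
by apply: ord_inj; rewrite lift_max.
Qed.

(** The keys of [s] are [0, ..., n - 1] in some order, and after the bump exactly the [r] smallest
    stay below [r]. *)
Lemma rank_bump_perm n (r : nat) (s : 'S_n) : r <= n ->
  rank r (map (bump r) (perm_keys s)) = r.
Proof.
move=> rn; have ps : perm_eq (perm_keys s) (iota 0 n).
  apply: uniq_perm; rewrite ?perm_keys_uniq ?iota_uniq // => k.
  rewrite mem_iota add0n /=; apply/mapP/idP => [[i _ ->]|kn]; first exact: ltn_ord.
  by exists (s^-1%g (Ordinal kn)); rewrite ?mem_enum ?permKV.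
rewrite /rank count_map (seq.permP ps).
rewrite -(subnKC rn) iotaD count_cat add0n.
have -> : count (preim (bump r) (fun k => k < r)) (iota 0 r) = size (iota 0 r).
  apply/eqP; rewrite -all_count; apply/allP => k; rewrite mem_iota /bump /=; lia.
have -> : count (preim (bump r) (fun k => k < r)) (iota r (n - r)) = 0.
  apply/eqP; rewrite -leqn0 leqNgt -has_count; apply/hasPn => k; rewrite mem_iota /bump /=.
  by lia.
by rewrite size_iota addn0.
Qed.

Lemma ltn_bump r : {mono bump r : x y / x < y}.
Proof. by move=> x y; rewrite /bump; lia. Qed.

(** The gap hit by the last key is [r], whatever the earlier pattern [s]; this independence yields
    the Markov property. *)
Lemma perm_profile_lift n (r : 'I_n.+1) (s : 'S_n) :
  perm_profile (lift_perm ord_max r s) = profile_insert r (perm_profile s).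
Proof.
rewrite /perm_profile perm_keys_lift rev_rcons /= -map_rev rev_profile_map; last first.
  exact: ltn_bump.
congr profile_insert; rewrite map_rev /rank count_rev -/(rank _ _).
by rewrite rank_bump_perm // -ltnS.
Qed.

Local Open Scope ring_scope.

Lemma big_perm_lift (V : nmodType) n (G : 'S_n.+1 -> V) :
  \sum_(pi : 'S_n.+1) G pi =
  \sum_(s : 'S_n) \sum_(r < n.+1) G (lift_perm ord_max r s).
Proof.
pose f (p : 'S_n * 'I_n.+1) := lift_perm ord_max p.2 p.1.
have finj : injective f.
  move=> [s r] [s' r'] /permP e; have := e ord_max; rewrite !lift_perm_id => /= rr.
  congr pair => //; apply/permP => k; have := e (lift ord_max k).
  by rewrite !lift_perm_lift /= rr => /lift_inj.
rewrite (reindex f) ?pair_big //=; apply: onW_bij; apply: inj_card_bij => //.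
by rewrite card_prod !card_Sn card_ord factS mulnC.
Qed.

(** A one-key leaf owns two gaps, neither of which creates a leaf; a full leaf owns three, each of
    which does. *)
Lemma sum_profile_insert (V : nmodType) (F : nat -> V) (l : seq nat) :
  all (fun s => (s == 1) || (s == 2))%N l ->
  \sum_(0 <= g < gaps l) F (size (profile_insert g l)) =
  F (size l) *+ (2 * count_mem 1%N l) + F (size l).+1 *+ (3 * count_mem 2%N l).
Proof.
elim: l F => [|s l IH] F /=; first by rewrite big_geq // !mulr0n addr0.
move=> /andP[hs hl].
(* Gaps beyond the first leaf act on the tail, which is one leaf shorter, so the induction
   hypothesis is used for [F] shifted by one. *)
have shift : \sum_(s.+1 <= g < gaps (s :: l)) F (size (profile_insert g (s :: l))) =
    F (size l).+1 *+ (2 * count_mem 1%N l) + F (size l).+2 *+ (3 * count_mem 2%N l).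
  rewrite -(IH (fun k => F k.+1)) // /gaps /= -/(gaps l) -{1}[s.+1]add0n big_addn.
  rewrite addKn; apply: eq_bigr => g _.
  by rewrite ifN ?addnK // -ltnNge addnS ltnS leq_addl.
rewrite (@big_cat_nat _ _ _ s.+1) //=; last by rewrite /gaps /= leq_addr.
rewrite shift; case/orP: hs => /eqP -> /=.
  rewrite !big_nat_recl // big_geq //= addr0 addrA -mulr2n -mulrnDr.
  by congr (_ *+ _ + _ *+ _); lia.
rewrite !big_nat_recl // big_geq //= addr0 addrCA.
have -> (x : V) : x + (x + x) = x *+ 3 by rewrite !mulrS mulr0n addr0.
rewrite -mulrnDr.
by congr (_ *+ _ + _ *+ _); lia.
Qed.

(** * The Markov chain and its moments *)

Definition mean_Ln (R : realType) (n : nat) (F : nat -> R) : R :=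
  (\sum_(pi : 'S_n) F (Ln pi)) / n`!%:R.

(** Every leaf owns two or three of the [n.+2] gaps. These bounds put the transition probability in
    [0, 1]. *)
Lemma Ln_bounds n (pi : 'S_n.+1) : (n.+2 <= 3 * Ln pi)%N && (2 * Ln pi <= n.+2)%N.
Proof.
have [-> <-] := perm_profileP pi; rewrite /gaps.
by elim: (perm_profile pi) => //= s l IH /andP[hs /IH]; case/orP: hs => /eqP ->; lia.
Qed.

(** This solves [c1 + c2 = size l], [2 * c1 + 3 * c2 = gaps l], written additively because
    subtraction in [nat] truncates. *)
Lemma profile_counts l : all (fun s => (s == 1) || (s == 2))%N l ->
  (2 * count_mem 1%N l + 2 * gaps l = 6 * size l)%N /\
  (3 * count_mem 2%N l + 6 * size l = 3 * gaps l)%N.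
Proof.
rewrite /gaps; elim: l => //= s l IH /andP[hs /IH].
by case/orP: hs => /eqP -> /=; lia.
Qed.

(* A key inserted at a uniformly random gap meets a full leaf with probability
   3 (#full leaves) / (#gaps), which the two linear relations of
   [profile_counts] express through the number of leaves alone. *)
Lemma mean_Ln_step (R : realType) n (F : nat -> R) :
  mean_Ln n.+2 F = mean_Ln n.+1 (fun l =>
     (1 - (3 - 6 * l%:R / n.+2%:R)) * F l + (3 - 6 * l%:R / n.+2%:R) * F l.+1).
Proof.
rewrite /mean_Ln big_perm_lift factS natrM invfM mulrA; congr (_ / _).
rewrite mulr_suml; apply: eq_bigr => s _.
have [eL eg al] := perm_profileP s.
have -> : \sum_(r < n.+2) F (Ln (lift_perm ord_max r s)) =
    \sum_(0 <= g < gaps (perm_profile s)) F (size (profile_insert g (perm_profile s))).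
  rewrite eg big_mkord; apply: eq_bigr => r _.
  by have [-> _ _] := perm_profileP (lift_perm ord_max r s); rewrite perm_profile_lift.
rewrite sum_profile_insert // -eL.
have [] := profile_counts al; rewrite eg -eL => e1 e2.
have {}e1 : (2 * count_mem 1%N (perm_profile s))%:R = 6 * (Ln s)%:R - 2 * n.+2%:R :> R.
  by apply/eqP; rewrite eq_sym subr_eq -!natrM -natrD eqr_nat e1.
have {}e2 : (3 * count_mem 2%N (perm_profile s))%:R = 3 * n.+2%:R - 6 * (Ln s)%:R :> R.
  by apply/eqP; rewrite eq_sym subr_eq -!natrM -natrD eqr_nat e2.
rewrite -[X in X + _]mulr_natl -[X in _ + X]mulr_natl e1 e2.
by field; rewrite -natrD pnatr_eq0.
Qed.

Lemma eq_mean_Ln (R : realType) n (F G : nat -> R) : F =1 G -> mean_Ln n F = mean_Ln n G.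
Proof. by move=> e; rewrite /mean_Ln; under eq_bigr do rewrite e. Qed.

Lemma mean_LnD (R : realType) n (F G : nat -> R) :
  mean_Ln n (fun l => F l + G l) = mean_Ln n F + mean_Ln n G.
Proof. by rewrite /mean_Ln big_split mulrDl. Qed.

Lemma mean_LnZ (R : realType) n (c : R) (F : nat -> R) :
  mean_Ln n (fun l => c * F l) = c * mean_Ln n F.
Proof. by rewrite /mean_Ln -mulr_sumr mulrA. Qed.

Lemma mean_LnB (R : realType) n (F G : nat -> R) :
  mean_Ln n (fun l => F l - G l) = mean_Ln n F - mean_Ln n G.
Proof. by rewrite /mean_Ln sumrB mulrBl. Qed.

Lemma mean_Ln_cst (R : realType) n (c : R) : mean_Ln n (fun=> c) = c.
Proof.
by rewrite /mean_Ln sumr_const card_Sn -[_ *+ _]mulr_natr mulfK.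
Qed.

Lemma le_mean_Ln (R : realType) n (F G : nat -> R) :
  (forall pi : 'S_n, F (Ln pi) <= G (Ln pi)) -> mean_Ln n F <= mean_Ln n G.
Proof. by move=> h; rewrite /mean_Ln ler_wpM2r ?invr_ge0 ?ler0n // ler_sum. Qed.

Lemma ler_norm_mean_Ln (R : realType) n (F : nat -> R) :
  `|mean_Ln n F| <= mean_Ln n (fun l => `|F l|).
Proof.
rewrite /mean_Ln normrM [X in _ * X <= _]ger0_norm ?invr_ge0 ?ler0n //.
by rewrite ler_wpM2r ?invr_ge0 ?ler0n // ler_norm_sum.
Qed.

Lemma mean_Ln_first_moment (R : realType) n :
  mean_Ln (n + 6) (fun l => l%:R) = 3 / 7 * (n + 7)%:R :> R.
Proof.
have step k : mean_Ln k.+2 (fun l => l%:R) =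
    3 + (1 - 6 / k.+2%:R) * mean_Ln k.+1 (fun l => l%:R) :> R.
  rewrite mean_Ln_step -mean_LnZ -[X in X + _](mean_Ln_cst (R := R) k.+1) -mean_LnD.
  apply: eq_mean_Ln => l; rewrite -natr1; field.
  by have := ler0n R k; lra.
(* From five keys to six the factor [1 - 6 / 6] vanishes, so the base case is independent of the
   mean at five. *)
elim: n => [|n IH]; first by rewrite !add0n step divff ?pnatr_eq0 // subrr mul0r; lra.
rewrite addSn (_ : n + 6 = (n + 5).+1)%N ?step -?addnS ?IH; last by lia.
rewrite !addSn !addnS -!natr1; field.
by have := ler0n R n; lra.
Qed.

Lemma mean_Ln_second_moment (R : realType) n :
  mean_Ln (n + 12) (fun l => l%:R ^+ 2) =
  9 / 49 * (n + 13)%:R ^+ 2 + 12 / 637 * (n + 13)%:R :> R.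
Proof.
(* Given [l], the square grows by [2 * l + 1] with probability [3 - 6 * l / k.+2]. *)
have step k : mean_Ln k.+2 (fun l => l%:R ^+ 2) =
    3 + (6 - 6 / k.+2%:R) * mean_Ln k.+1 (fun l => l%:R)
    + (1 - 12 / k.+2%:R) * mean_Ln k.+1 (fun l => l%:R ^+ 2) :> R.
  rewrite mean_Ln_step -!mean_LnZ -[X in X + _ + _](mean_Ln_cst (R := R) k.+1) -!mean_LnD.
  apply: eq_mean_Ln => l; rewrite -[l.+1%:R]natr1; field.
  by have := ler0n R k; lra.
elim: n => [|n IH].
  have h : mean_Ln 11 (fun l => l%:R) = 3 / 7 * 12%:R :> R := mean_Ln_first_moment R 5.
  by rewrite !add0n step h divff ?pnatr_eq0 // subrr mul0r; lra.
rewrite addSn (_ : n + 12 = (n + 11).+1)%N ?step -?addnS ?IH; last by lia.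
rewrite (_ : n + 12 = (n + 6) + 6)%N ?mean_Ln_first_moment; last by lia.
rewrite (_ : (n + 6) + 7 = n + 13)%N; last by lia.
rewrite addSn -[(n + 13).+1%:R]natr1.
have : (n + 13)%:R != 0 :> R by rewrite pnatr_eq0 addnS.
by move: (n + 13)%:R => m m0; field.
Qed.

Lemma ELnE (R : realType) n : (5 < n)%N -> ELn R n = 3 / 7 * n.+1%:R.
Proof.
move=> n5; rewrite -[ELn R n]/(mean_Ln n (fun l => l%:R)).
rewrite -{1}(subnK n5) mean_Ln_first_moment.
by congr (_ * _%:R); lia.
Qed.

Lemma VLnE (R : realType) n : (11 < n)%N -> VLn R n = 12 / 637 * n.+1%:R.
Proof.
move=> n11; rewrite /VLn ELnE; last by lia.
have -> : n = (n - 12 + 12)%N by lia.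
move: (n - 12)%N => {n n11} n.
rewrite -/(mean_Ln _ (fun l => (l%:R - 3 / 7 * (n + 12).+1%:R) ^+ 2)).
set c := 3 / 7 * _.
have -> : mean_Ln (n + 12) (fun l => (l%:R - c) ^+ 2) =
    mean_Ln (n + 12) (fun l => l%:R ^+ 2) - 2 * c * mean_Ln (n + 12) (fun l => l%:R) + c ^+ 2.
  rewrite -!mean_LnZ -[c ^+ 2](mean_Ln_cst (R := R) (n + 12)) -mean_LnB -mean_LnD.
  by apply: eq_mean_Ln => l; rewrite sqrrB; ring.
rewrite mean_Ln_second_moment (_ : n + 12 = (n + 6) + 6)%N ?mean_Ln_first_moment; last by lia.
rewrite /c (_ : (n + 6) + 7 = n + 13)%N; last by lia.
by rewrite -[(n + 12).+1]addnS; field.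
Qed.

(** The subtracted term is the mean from [n = 6] on, and extends its formula below. *)
Definition centered (R : realType) n (l : nat) : R := l%:R - 3 / 7 * n.+1%:R.

(** Past eleven keys this is the variance. Before, with [m = n.+2 <= 12] and [0 <= L <= m / 2], the
    square is at most [m ^+ 2 <= 12 * m]. *)
Lemma mean_Ln_sqr_centered (R : realType) n :
  mean_Ln n.+1 (fun l => centered R n.+1 l ^+ 2) <= 12 * n.+2%:R.
Proof.
have [n11|n11] := ltnP 11 n.+1.
  have := VLnE R n11; rewrite /VLn ELnE; last by lia.
  rewrite -/(mean_Ln _ (fun l => (l%:R - 3 / 7 * n.+2%:R) ^+ 2)) => ->.
  by rewrite ler_wpM2r ?ler0n //; lra.
rewrite -[leRHS](mean_Ln_cst (R := R) n.+1); apply: le_mean_Ln => pi.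
have /andP[_ h] := Ln_bounds pi.
have h1 : (Ln pi)%:R * 2 <= n.+2%:R :> R by rewrite -natrM ler_nat mulnC.
have h2 : n.+2%:R <= 12 :> R by rewrite ler_nat.
have h3 : 0 <= (Ln pi)%:R :> R by [].
have h4 : 0 <= n.+2%:R :> R by [].
rewrite /centered; set m := n.+2%:R in h1 h2 h4 *; set L := _%:R in h1 h3 *.
by nra.
Qed.

Local Open Scope classical_set_scope.
Import numFieldNormedType.Exports.

(** * The normal distribution function *)

Definition Phi (R : realType) (x : R) : R := fine (normal_prob (0 : R) 1 `]-oo, x]).

Definition phi (R : realType) (x : R) : R := normal_pdf 0 1 x.

Lemma PhiE (R : realType) (x : R) : normal_prob (0 : R) 1 `]-oo, x] = (Phi x)%:E.
Proof. by rewrite /Phi fineK // fin_num_measure. Qed.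

Lemma Phi_ge0 (R : realType) (x : R) : 0 <= Phi x.
Proof. by rewrite -lee_fin -PhiE measure_ge0. Qed.

Lemma Phi_le1 (R : realType) (x : R) : Phi x <= 1.
Proof. by rewrite -lee_fin -PhiE probability_le1. Qed.

Lemma Phi_nondecreasing (R : realType) : {homo @Phi R : x y / x <= y}.
Proof.
move=> x y xy; rewrite -lee_fin -!PhiE le_measure ?inE //; exact: subitvPr.
Qed.

(** As a random variable under the normal law it has distribution function [Phi], which gives the
    limits of [Phi] at infinity. *)
Definition id_real (R : realType) : measurableTypeR R -> R := idfun.

HB.instance Definition _ (R : realType) :=
  @isMeasurableFun.Build _ _ (measurableTypeR R) R (@id_real R) (@measurable_id _ _ setT).

Lemma Phi_cvgNy (R : realType) : @Phi R x @[x --> -oo] --> (0 : R).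
Proof.
by move/fine_cvgP: (cvg_cdfNy0 (@id_real R : {RV (normal_prob (0 : R) 1) >-> R})) => [].
Qed.

Lemma Phi_cvgy (R : realType) : @Phi R x @[x --> +oo] --> (1 : R).
Proof.
by move/fine_cvgP: (cvg_cdfy1 (@id_real R : {RV (normal_prob (0 : R) 1) >-> R})) => [].
Qed.

Lemma phiE (R : realType) (x : R) :
  phi x = normal_peak 1 * expR (- (x ^+ 2 / 2)).
Proof.
rewrite /phi normal_pdfE ?oner_neq0 // /normal_fun.
by rewrite subr0 mulNr expr1n.
Qed.

Lemma is_derive_Phi (R : realType) (x : R) : is_derive x 1 (@Phi R) (phi x).
Proof.
have [] := @continuous_FTC1 R (normal_pdf 0 1) -oo%O x (x + 1).
- by rewrite ltrDl.
- apply: (integrableS _ _ (subsetT _)) => //; exact: integrable_normal_pdf.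
- by rewrite ltNyr.
- apply: continuous_normal_pdf; exact: oner_neq0.
by move=> df e; rewrite /phi -e derive1E; exact/derivableP.
Qed.

Lemma is_derive_phi (R : realType) (x : R) : is_derive x 1 (@phi R) (- x * phi x).
Proof.
have -> : @phi R = (fun y => normal_peak 1 * expR (- (y ^+ 2 / 2))).
  by apply/funext => y; rewrite phiE.
apply: is_derive_eq.
by rewrite /GRing.scale /=; field.
Qed.

(** [psi] and [chi] are the second and third derivatives of [Phi]. *)
Definition psi (R : realType) (x : R) : R := - x * phi x.

Definition chi (R : realType) (x : R) : R := (x ^+ 2 - 1) * phi x.

Lemma is_derive_psi (R : realType) (x : R) : is_derive x 1 (@psi R) (chi x).
Proof.
have h := is_derive_phi x.
apply: is_derive_eq.
by rewrite /chi /GRing.scale /=; ring.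
Qed.

Lemma phi_gt0 (R : realType) (x : R) : 0 < phi x.
Proof. by rewrite phiE mulr_gt0 ?expR_gt0 // normal_peak_gt0 ?oner_neq0. Qed.

(** Square [1 + y <= expR y] at [y = x ^+ 2 / 4]. Decay of order four controls the cubic factor in
    [x * chi x]. *)
Lemma phi_decay (R : realType) (x : R) : phi x * (1 + x ^+ 2 / 4) ^+ 2 <= normal_peak 1.
Proof.
rewrite phiE -mulrA ler_piMr ?normal_peak_ge0 //.
have -> : x ^+ 2 / 2 = x ^+ 2 / 4 + x ^+ 2 / 4 by field.
rewrite opprD expRD expRN -expr2 -exprMn exprn_ile1 //.
  by rewrite mulr_ge0 ?invr_ge0 ?expR_ge0 // addr_ge0 // divr_ge0 ?sqr_ge0.
by rewrite mulrC ler_pdivrMr ?expR_gt0 // mul1r expR_ge1Dx.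
Qed.

Lemma phi_psi_chi_bounded (R : realType) : exists2 K : R, 0 < K &
  forall x, [/\ `|phi x| <= K, `|psi x| <= K, `|chi x| <= K & `|x * chi x| <= K].
Proof.
exists (20 * normal_peak 1); first by rewrite mulr_gt0 // normal_peak_gt0 ?oner_neq0.
move=> x; have := phi_decay x; have := phi_gt0 x; rewrite /psi /chi.
set f := phi x; set N := normal_peak 1 => f0 h.
have hN : f * (1 + x ^+ 2 / 2 + x ^+ 4 / 16) <= N.
  by apply: le_trans h; rewrite le_eqVlt; apply/orP; left; apply/eqP; field.
(* Weighted squares bound the odd powers of [x] by even ones, after which the claims are linear. *)
have b0 : 0 <= f * x ^+ 2 by rewrite mulr_ge0 ?sqr_ge0 // ltW.
have b1 : 0 <= f * x ^+ 4 by rewrite mulr_ge0 ?exprn_even_ge0 // ltW.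
have b2 : 0 <= f * (x - 1) ^+ 2 by rewrite mulr_ge0 ?sqr_ge0 // ltW.
have b3 : 0 <= f * (x + 1) ^+ 2 by rewrite mulr_ge0 ?sqr_ge0 // ltW.
have b4 : 0 <= f * (x ^+ 2 - x) ^+ 2 by rewrite mulr_ge0 ?sqr_ge0 // ltW.
have b5 : 0 <= f * (x ^+ 2 + x) ^+ 2 by rewrite mulr_ge0 ?sqr_ge0 // ltW.
by split; rewrite ler_norml; apply/andP; split; lra.
Qed.

(** Distances replace an interval so that increments of either sign are covered. *)
Lemma mean_value (R : realType) (f f' : R -> R) (a b : R) :
  (forall x : R, is_derive x 1 f (f' x)) ->
  exists2 c, `|c - a| <= `|b - a| & f b - f a = f' c * (b - a).
Proof.
move=> df; have cf : continuous f.
  by move=> x; apply/differentiable_continuous/derivable1_diffP.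
have [ab|ab] := leP a b.
  have [c] := MVT_segment ab (fun x _ => df x) (continuous_subspaceT cf).
  rewrite in_itv /= => /andP[ac cb] e; exists c => //.
  by rewrite !ger0_norm ?subr_ge0 //; lra.
have [c] := MVT_segment (ltW ab) (fun x _ => df x) (continuous_subspaceT cf).
rewrite in_itv /= => /andP[ac cb] e; exists c; last by lra.
by rewrite !ler0_norm ?subr_le0 //; lra.
Qed.

Lemma Phi_lipschitz (R : realType) : exists2 K : R, 0 < K &
  forall a b : R, `|Phi b - Phi a| <= K * `|b - a|.
Proof.
have [K K0 hK] := phi_psi_chi_bounded R; exists K => // a b.
have [c _ ->] := mean_value a b (@is_derive_Phi R).
by rewrite normrM ler_wpM2r //; have [] := hK c.
Qed.

(** The derivative in [h] of the remainder is the first-order remainder of [phi], itself quadratic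
    by two uses of the mean value theorem. *)
Lemma Phi_taylor (R : realType) : exists2 K : R, 0 < K & forall x h : R,
  `|Phi (x + h) - Phi x - phi x * h - psi x * h ^+ 2 / 2| <= K * `|h| ^+ 3.
Proof.
have [K K0 hK] := phi_psi_chi_bounded R; exists K => // x h.
have phi2 y : `|phi (x + y) - phi x - psi x * y| <= K * `|y| ^+ 2.
  have [c] := mean_value x (x + y) (@is_derive_phi R).
  rewrite (addrC x) addrK => c1; rewrite -/(psi c) (addrC y) => ->.
  have [d _] := mean_value x c (@is_derive_psi R).
  rewrite -mulrBl normrM => ->; rewrite normrM expr2 mulrA.
  rewrite ler_wpM2r // ler_pM //.
  by have [] := hK d.
pose g y := Phi (x + y) - Phi x - phi x * y - psi x * y ^+ 2 / 2.
have dg (y : R) : is_derive y 1 g (phi (x + y) - phi x - psi x * y).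
  have h1 : is_derive y 1 (fun y => Phi (x + y)) (phi (x + y)).
    rewrite -[phi _]mulr1; apply: (@is_derive1_comp R (@Phi R) (fun y => x + y)).
      exact: is_derive_Phi.
    by apply: is_derive_eq; rewrite add0r mulr1.
  apply: is_derive_eq.
  by rewrite /GRing.scale /=; field.
have [c] := mean_value 0 h dg.
rewrite !subr0 /g !(addr0, subrr, mulr0, expr0n, mul0r, subr0) => ch ->.
rewrite normrM exprSr mulrA ler_wpM2r //.
apply: le_trans (phi2 c) _; rewrite ler_wpM2l ?(ltW K0) //.
by rewrite lerXn2r ?nnegrE.
Qed.

Lemma mean_value_right (R : realType) (f f' : R -> R) (a b : R) : a <= b ->
  (forall x : R, a <= x -> is_derive x 1 f (f' x)) ->
  exists2 c, a <= c <= b & f b - f a = f' c * (b - a).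
Proof.
move=> ab df.
have df' (x : R) : x \in `]a, b[%R -> is_derive x 1 f (f' x).
  by rewrite in_itv /= => /andP[/ltW ax _]; exact: df.
have [|c] := MVT_segment ab df'; last by rewrite in_itv /= => ? ?; exists c.
apply: derivable_within_continuous => x; rewrite in_itv /= => /andP[ax _].
by have [] := df x ax.
Qed.

(* [Phi (x / sqrt u)] solves the heat equation: its derivative in the variance
   [u] is half its second derivative in [x]. *)
Lemma is_derive_Phi_scale (R : realType) (x u : R) : 0 < u ->
  is_derive u 1 (fun u => Phi (x / Num.sqrt u)) (psi (x / Num.sqrt u) / (2 * u)) /\
  is_derive u 1 (fun u => psi (x / Num.sqrt u) / (2 * u))
    (- (x / Num.sqrt u * chi (x / Num.sqrt u)) / (4 * u ^+ 2)
     - psi (x / Num.sqrt u) / (2 * u ^+ 2)).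
Proof.
move=> u0; have s0 : Num.sqrt u != 0 by rewrite gt_eqF ?sqrtr_gt0.
have dg : is_derive u 1 (fun u => x / Num.sqrt u) (- (x / Num.sqrt u) / (2 * u)).
  have h := is_derive1_sqrt u0.
  apply: is_derive_eq.
  rewrite sqr_sqrtr ?ltW // /GRing.scale /=.
  by field; rewrite s0 gt_eqF.
split.
  rewrite (_ : psi _ / _ = phi (x / Num.sqrt u) * (- (x / Num.sqrt u) / (2 * u))).
    apply: (@is_derive1_comp R (@Phi R) (fun u => x / Num.sqrt u)) => //.
    exact: is_derive_Phi.
  by rewrite /psi; ring.
have h : is_derive u 1 (fun u => psi (x / Num.sqrt u))
    (chi (x / Num.sqrt u) * (- (x / Num.sqrt u) / (2 * u))).
  apply: (@is_derive1_comp R (@psi R) (fun u => x / Num.sqrt u)) => //.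
  exact: is_derive_psi.
have u0' : 2 * u != 0 by rewrite mulf_neq0 ?gt_eqF.
apply: is_derive_eq.
rewrite /GRing.scale /=.
by field; rewrite gt_eqF.
Qed.

(** The second derivative in the variance is at most [K / v ^+ 2] beyond [v], uniformly in [x],
    which enters only through [x / Num.sqrt u]. *)
Lemma Phi_scale_taylor (R : realType) : exists2 K : R, 0 < K &
  forall x v h : R, 0 < v -> 0 <= h ->
  `|Phi (x / Num.sqrt (v + h)) - Phi (x / Num.sqrt v)
    - h * (psi (x / Num.sqrt v) / (2 * v))| <= K * (h / v) ^+ 2.
Proof.
have [K K0 hK] := phi_psi_chi_bounded R; exists K => // x v h v0 h0.
have vh : v <= v + h by rewrite lerDl.
have [c /andP[vc cvh]] := mean_value_right vh
  (fun u vu => (is_derive_Phi_scale x (lt_le_trans v0 vu)).1).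
rewrite addrAC subrr add0r => ->.
have [d /andP[vd dc]] := mean_value_right vc
  (fun u vu => (is_derive_Phi_scale x (lt_le_trans v0 vu)).2).
rewrite [h * _]mulrC -mulrBl normrM => ->; rewrite normrM.
rewrite (ger0_norm h0) (@ger0_norm _ (c - v)) ?subr_ge0 //.
have d0 : 0 < d := lt_le_trans v0 vd.
have -> : K * (h / v) ^+ 2 = K / v ^+ 2 * h * h by field; rewrite gt_eqF.
rewrite ler_wpM2r // ler_pM ?subr_ge0 //; last by lra.
have [_ + _ +] := hK (x / Num.sqrt d).
set P := psi _; set X := _ * chi _ => hP hX.
have -> : - X / (4 * d ^+ 2) - P / (2 * d ^+ 2) = (- X / 4 - P / 2) / d ^+ 2.
  by field; rewrite gt_eqF.
rewrite normrM [X in _ * X <= _]ger0_norm ?invr_ge0 ?sqr_ge0 //.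
rewrite ler_pM ?invr_ge0 ?sqr_ge0 //.
  by move: hP hX; rewrite !ler_norml => /andP[? ?] /andP[? ?]; apply/andP; split; lra.
by rewrite lef_pV2 ?posrE ?exprn_gt0 // lerXn2r ?nnegrE ?(ltW v0) ?(ltW d0).
Qed.

(* A centred Bernoulli step of size [a] changes the Gaussian smoothing like a
   decrease of the variance by [a ^+ 2 * (p * (1 - p))]. *)
Lemma Phi_bernoulli_step (R : realType) : exists2 K : R, 0 < K &
  forall t y a p v h : R, 0 <= p <= 1 -> 0 <= a -> 0 < v -> 0 <= h ->
  `|(1 - p) * Phi ((t - (y - a * p)) / Num.sqrt v)
    + p * Phi ((t - (y + a * (1 - p))) / Num.sqrt v)
    - Phi ((t - y) / Num.sqrt (v + h))|
  <= K * (`|a ^+ 2 * (p * (1 - p)) - h| / v + (a / Num.sqrt v) ^+ 3 + (h / v) ^+ 2).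
Proof.
have [K0 K00 hK0] := phi_psi_chi_bounded R.
have [K1 K10 hK1] := Phi_taylor R.
have [K2 K20 hK2] := Phi_scale_taylor R.
exists (K0 + K1 + K2) => [|t y a p v h /andP[p0 p1] a0 v0 h0].
  by rewrite !addr_gt0.
have s0 : 0 < Num.sqrt v by rewrite sqrtr_gt0.
set s := Num.sqrt v in s0 *.
have es : s ^+ 2 = v by rewrite sqr_sqrtr // ltW.
set w := (t - y) / s; set b := a / s.
have b0 : 0 <= b by rewrite divr_ge0 // ltW.
have -> : (t - (y - a * p)) / s = w + b * p by rewrite /w /b; field; rewrite gt_eqF.
have -> : (t - (y + a * (1 - p))) / s = w + - (b * (1 - p)).
  by rewrite /w /b; field; rewrite gt_eqF.
have q0 : 0 <= 1 - p by lra.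
have cube (r : R) : 0 <= r -> r <= 1 -> `|b * r| ^+ 3 <= b ^+ 3.
  move=> r0 r1; have br := mulr_ge0 b0 r0.
  by rewrite ger0_norm // lerXn2r ?nnegrE // ler_piMr.
have T1 := hK1 w (b * p); have T2 := hK1 w (- (b * (1 - p))).
have T3 := hK2 (t - y) v h v0 h0; rewrite -/s -/w in T3.
have [_ hpsi _ _] := hK0 w.
set A1 := Phi (w + b * p) in T1 *; set A2 := Phi (w + _) in T2 *.
set A3 := Phi (_ / _) in T3 *.
set D1 := _ - _ - _ - _ in T1; set D2 := _ - _ - _ - _ in T2; set D3 := _ - _ - _ in T3.
(* First-order terms cancel as the step is centred; at second order only the mismatch between
   [a ^+ 2 * (p * (1 - p))] and [h] survives. *)
have -> : (1 - p) * A1 + p * A2 - A3 =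
    psi w / 2 * ((a ^+ 2 * (p * (1 - p)) - h) / v) + (1 - p) * D1 + p * D2 - D3.
  by rewrite /D1 /D2 /D3 /b -es; field; rewrite gt_eqF.
have {}T1 : `|D1| <= K1 * b ^+ 3.
  by apply: le_trans T1 _; rewrite ler_wpM2l ?(ltW K10) // cube //; lra.
have {}T2 : `|D2| <= K1 * b ^+ 3.
  by apply: le_trans T2 _; rewrite normrN ler_wpM2l ?(ltW K10) // cube //; lra.
set E := _ - h.
have e0 : 0 <= `|E| / v by rewrite divr_ge0 // ltW.
have T4 : `|psi w / 2 * (E / v)| <= K0 * (`|E| / v).
  move: (psi w) hpsi => P hP; rewrite !normrM !normfV (@gtr0_norm _ v) // (@gtr0_norm _ 2) //.
  have := ler_wpM2r e0 hP.
  have : 0 <= `|P| * (`|E| / v) by rewrite mulr_ge0.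
  by lra.
have b3 : 0 <= b ^+ 3 by rewrite exprn_ge0.
have h2 : 0 <= (h / v) ^+ 2 by rewrite sqr_ge0.
have T5 : `|(1 - p) * D1 + p * D2| <= K1 * b ^+ 3.
  apply: le_trans (ler_normD _ _) _; rewrite !normrM (ger0_norm q0) (ger0_norm p0).
  apply: (@le_trans _ _ ((1 - p) * (K1 * b ^+ 3) + p * (K1 * b ^+ 3))); last by lra.
  by rewrite lerD // ler_wpM2l.
have [k0 k1 k2] := And3 (ltW K00) (ltW K10) (ltW K20).
have := mulr_ge0 k0 b3; have := mulr_ge0 k0 h2; have := mulr_ge0 k1 e0.
have := mulr_ge0 k1 h2; have := mulr_ge0 k2 e0; have := mulr_ge0 k2 b3.
move: T3 T4 T5; rewrite !ler_norml => /andP[? ?] /andP[? ?] /andP[? ?] *.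
by apply/andP; split; lra.
Qed.

(** * Smoothed central limit theorem *)

Definition limit_variance (R : realType) : R := 12 / 637.

Lemma limit_variance_gt0 (R : realType) : 0 < limit_variance R.
Proof. by rewrite divr_gt0 ?ltr0n. Qed.

(* Each step multiplies the conditional mean of [centered] by [1 - 6 / j.+1];
   falling factorials undo this contraction, and the normalisation makes the
   variance equal to 1 at time [N]. *)
Definition martingale_coef (R : realType) (N j : nat) : R :=
  (j ^_ 6)%:R / (N ^_ 6)%:R / Num.sqrt (limit_variance R * N.+1%:R).

Lemma ler_ffact n m k : (n <= m -> n ^_ k <= m ^_ k)%N.
Proof. by move=> nm; elim: k => // k IH; rewrite !ffactnSr leq_mul // leq_sub2r. Qed.

Lemma coef_ge0 (R : realType) N j : 0 <= martingale_coef R N j.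
Proof. by rewrite /martingale_coef divr_ge0 // divr_ge0. Qed.

Lemma coef_step (R : realType) N j : (4 < j)%N ->
  martingale_coef R N j = martingale_coef R N j.+1 * (1 - 6 / j.+1%:R).
Proof.
move=> j4; rewrite /martingale_coef [RHS]mulrAC; congr (_ / _); rewrite [RHS]mulrAC; congr (_ / _).
have e : (j.+1 ^_ 6)%:R * ((j - 5)%:R) = (j ^_ 6)%:R * j.+1%:R :> R.
  by rewrite -!natrM ffactSS [in RHS]ffactnSr -mulnA mulnC.
rewrite natrB // in e.
have -> : 1 - 6 / j.+1%:R = (j%:R - 5%:R) / j.+1%:R :> R.
  rewrite -natr1; field; have := ler0n R j; lra.
by rewrite mulrA e mulfK.
Qed.

Lemma coef_diag (R : realType) N : (5 < N)%N ->
  martingale_coef R N N = (Num.sqrt (limit_variance R * N.+1%:R))^-1.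
Proof. by move=> N5; rewrite /martingale_coef divff ?mul1r // pnatr_eq0 -lt0n ffact_gt0. Qed.

(** One factor of the falling factorials gives [j * N.+1 <= N * j.+1]; the other five are
    monotone. *)
Lemma coef_decay (R : realType) N j : (5 < N)%N -> (j <= N)%N ->
  martingale_coef R N j * N.+1%:R <= martingale_coef R N N * j.+1%:R.
Proof.
move=> N5 jN; have E (x y z k : R) : x / y / z * k = x * k * (y^-1 / z) by ring.
rewrite /martingale_coef [leLHS]E [leRHS]E ler_wpM2r ?divr_ge0 ?invr_ge0 // -!natrM ler_nat.
case: j jN => [|j] jN; first by rewrite ffact_small.
case: N N5 jN => [//|N] _; rewrite ltnS => jN.
rewrite !ffactSS mulnAC [leqRHS]mulnAC; apply: leq_mul; last exact: ler_ffact.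
by rewrite (mulnS j.+1) (mulnS N.+1) (mulnC N.+1) leq_add2r.
Qed.

(** Here [a] and [b] are the coefficients at [j] and [N], [k] is [j.+1] and [r] is the root of
    [N.+1]. One factor [k / r ^+ 2 <= 1] is given up in the second bound. *)
Lemma decay_bounds (R : realFieldType) (a b k r : R) : 0 < r -> k <= r ^+ 2 ->
  0 <= a -> 0 <= b -> b <= 8 / r -> 0 <= k -> a * r ^+ 2 <= b * k ->
  a <= b /\ a ^+ 2 <= 64 * k / r ^+ 4.
Proof.
move=> r0 kr a0 b0 b8 k0 h; have r2 : 0 < r ^+ 2 by rewrite exprn_gt0.
have ab : a <= b by rewrite -(ler_pM2r r2) (le_trans h) // ler_wpM2l.
split => //; have b2 : b ^+ 2 <= 64 / r ^+ 2.
  have -> : 64 / r ^+ 2 = (8 / r) ^+ 2 by field; rewrite gt_eqF.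
  by rewrite lerXn2r ?nnegrE // divr_ge0 // ltW.
rewrite ler_pdivlMr ?exprn_gt0 //.
have -> : a ^+ 2 * r ^+ 4 = (a * r ^+ 2) * (a * r ^+ 2) by ring.
have -> : 64 * k = k * (64 / r ^+ 2) * r ^+ 2 by field; rewrite gt_eqF.
have ar := mulr_ge0 a0 (ltW r2).
apply: (@le_trans _ _ ((b * k) * (b * r ^+ 2))).
  by rewrite ler_pM // ler_wpM2r // ltW.
have -> : b * k * (b * r ^+ 2) = k * b ^+ 2 * r ^+ 2 by ring.
by rewrite ler_wpM2r ?(ltW r2) // ler_wpM2l.
Qed.

(** With [p = 3 / 7 - z], the error is linear in [z] up to squares; [2 * |z| <= r^-1 + r * z ^+ 2]
    trades it for a term whose mean is known. *)
Lemma bernoulli_variance_error (R : realFieldType) (a m r z : R) :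
  0 < m -> 1 <= r ->
  `|a ^+ 2 * ((3 / 7 - z) * (1 - (3 / 7 - z))) - a ^+ 2 * (12 / 49 - 36 * (12 / 637) / m)|
  <= a ^+ 2 * (r^-1 + m^-1 + 2 * r * z ^+ 2).
Proof.
move=> m0 r1; have r0 : 0 < r by apply: lt_le_trans r1.
have -> : a ^+ 2 * ((3 / 7 - z) * (1 - (3 / 7 - z))) - a ^+ 2 * (12 / 49 - 36 * (12 / 637) / m)
    = a ^+ 2 * (432 / 637 / m - z / 7 - z ^+ 2) by field; rewrite gt_eqF.
rewrite normrM ger0_norm ?sqr_ge0 // ler_wpM2l ?sqr_ge0 //.
have mi : 0 < m^-1 by rewrite invr_gt0.
have ri : 0 < r^-1 by rewrite invr_gt0.
have z2 : 0 <= z ^+ 2 by rewrite sqr_ge0.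
have rz : z ^+ 2 <= r * z ^+ 2 by rewrite ler_peMl.
have h1 : 0 <= r^-1 * (r * z - 1) ^+ 2 by rewrite mulr_ge0 ?sqr_ge0 // ltW.
have h2 : 0 <= r^-1 * (r * z + 1) ^+ 2 by rewrite mulr_ge0 ?sqr_ge0 // ltW.
have e1 : r^-1 * (r * z - 1) ^+ 2 = r * z ^+ 2 - 2 * z + r^-1 by field; rewrite gt_eqF.
have e2 : r^-1 * (r * z + 1) ^+ 2 = r * z ^+ 2 + 2 * z + r^-1 by field; rewrite gt_eqF.
rewrite e1 in h1; rewrite e2 in h2.
rewrite ler_norml; apply/andP; split; lra.
Qed.

Lemma step_error_bound (R : rcfType) (a h v r e : R) : 0 <= a -> a <= 8 / r -> 1 <= r ->
  0 < e -> e ^+ 2 <= v -> 0 <= h <= a ^+ 2 ->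
  (a / Num.sqrt v) ^+ 3 + (h / v) ^+ 2 <= (8 ^+ 3 / e ^+ 3 + 8 ^+ 4 / e ^+ 4) / r ^+ 3.
Proof.
move=> a0 a8 r1 e0 ev /andP[h0 ha]; have r0 : 0 < r by apply: lt_le_trans r1.
have es : e <= Num.sqrt v by rewrite -[e]ger0_norm ?(ltW e0) // -sqrtr_sqr ler_wsqrtr.
have s0 : 0 < Num.sqrt v by apply: lt_le_trans es.
have v0 : 0 < v by rewrite -sqrtr_gt0.
have h1 : a / Num.sqrt v <= 8 / r / e.
  by rewrite ler_pM ?invr_ge0 ?(ltW s0) // lef_pV2.
have h2 : a ^+ 2 / v <= (8 / r / e) ^+ 2.
  rewrite exprMn exprVn ler_pM ?sqr_ge0 ?invr_ge0 ?(ltW v0) //.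
    by rewrite lerXn2r ?nnegrE // (le_trans a0).
  by rewrite lef_pV2 // posrE exprn_gt0.
have h3 : h / v <= (8 / r / e) ^+ 2.
  by apply: le_trans h2; rewrite ler_wpM2r ?invr_ge0 ?(ltW v0).
have b0 : 0 <= 8 / r / e by rewrite !divr_ge0 ?(ltW r0) ?(ltW e0).
apply: (@le_trans _ _ ((8 / r / e) ^+ 3 + ((8 / r / e) ^+ 2) ^+ 2)).
  rewrite lerD // lerXn2r ?nnegrE ?sqr_ge0 ?exprn_ge0 // divr_ge0 ?(ltW s0) ?(ltW v0) //.
have -> : (8 / r / e) ^+ 3 + ((8 / r / e) ^+ 2) ^+ 2 =
    8 ^+ 3 / e ^+ 3 / r ^+ 3 + 8 ^+ 4 / e ^+ 4 / r ^+ 3 / r.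
  by field; rewrite !gt_eqF.
rewrite [leRHS]mulrDl lerD // ler_pdivrMr // ler_peMr //.
by rewrite !divr_ge0 ?exprn_ge0 ?(ltW r0) ?(ltW e0).
Qed.

(** The term in [r^-1] uses [a <= 8 / r]; the terms in [m^-1] need the sharper
    [a ^+ 2 = O(m / r ^+ 4)], which cancels [m]. *)
Lemma mean_step_error (R : realFieldType) (a m r E D : R) : 1 <= m -> 1 <= r ->
  a ^+ 2 <= 64 * (m + 1) / r ^+ 4 -> a <= 8 / r -> 0 <= a -> 0 <= D -> E <= D / m ->
  a ^+ 2 * (r^-1 + m^-1 + 2 * r * E) <= 64 * (1 + 2 * (1 + 2 * D)) / r ^+ 3.
Proof.
move=> m1 r1 h1 h2 a0 D0 hE; have r0 : 0 < r by apply: lt_le_trans r1.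
have m0 : 0 < m by apply: lt_le_trans m1.
have A : a ^+ 2 * r^-1 <= 64 / r ^+ 3.
  have -> : 64 / r ^+ 3 = (8 / r) ^+ 2 * r^-1 by field; rewrite gt_eqF.
  by rewrite ler_wpM2r ?invr_ge0 ?(ltW r0) // lerXn2r ?nnegrE // (le_trans a0).
have k0 : 0 <= (1 + 2 * D) * r / m.
  by rewrite divr_ge0 ?(ltW m0) // mulr_ge0 ?(ltW r0) // addr_ge0 // mulr_ge0.
have B : a ^+ 2 * ((1 + 2 * D) * r / m) <= 64 * (2 * (1 + 2 * D)) / r ^+ 3.
  have -> : 64 * (2 * (1 + 2 * D)) / r ^+ 3 =
      64 * (2 * m) / r ^+ 4 * ((1 + 2 * D) * r / m) by field; rewrite !gt_eqF.
  rewrite ler_wpM2r // (le_trans h1) // ler_wpM2r ?invr_ge0 ?exprn_ge0 ?(ltW r0) //.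
  by lra.
have C : r^-1 + m^-1 + 2 * r * E <= r^-1 + (1 + 2 * D) * r / m.
  rewrite -addrA lerD2l.
  have -> : (1 + 2 * D) * r / m = r * m^-1 + 2 * r * (D / m) by field; rewrite gt_eqF.
  apply: lerD; first by rewrite ler_peMl ?invr_ge0 ?(ltW m0).
  by rewrite ler_wpM2l // mulr_ge0 ?(ltW r0).
apply: le_trans (ler_wpM2l (sqr_ge0 a) C) _; rewrite mulrDr.
have -> : 64 * (1 + 2 * (1 + 2 * D)) / r ^+ 3 =
    64 / r ^+ 3 + 64 * (2 * (1 + 2 * D)) / r ^+ 3 by field; rewrite gt_eqF.
exact: lerD.
Qed.

(** * Telescoping the smoothed means along the martingale *)

Section Telescope.

Variables (R : realType) (e t : R) (N : nat).
Hypotheses (e0 : 0 < e) (N11 : (11 < N)%N).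

Let r : R := Num.sqrt N.+1%:R.

Definition martingale j (l : nat) : R := martingale_coef R N j * centered R j l.

(** From [j = 12] on the subtracted term is the variance of [martingale j]; below, the same formula
    is kept, so the recursion in [j] is purely algebraic. *)
Definition residual_variance j : R :=
  1 + e ^+ 2 - martingale_coef R N j ^+ 2 * (limit_variance R * j.+1%:R).

Definition smoothed j (l : nat) : R :=
  Phi ((t - martingale j l) / Num.sqrt (residual_variance j)).

Let r_sqr : r ^+ 2 = N.+1%:R.
Proof. by rewrite sqr_sqrtr. Qed.

Let r_ge1 : 1 <= r.
Proof. by rewrite -sqrtr1 ler_sqrt // ler1n. Qed.

Let coefN_sqr : martingale_coef R N N ^+ 2 * (limit_variance R * r ^+ 2) = 1.
Proof.
have v0 : 0 < limit_variance R * N.+1%:R by rewrite mulr_gt0 ?limit_variance_gt0 ?ltr0n.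
rewrite r_sqr coef_diag; last by lia.
by rewrite exprVn (sqr_sqrtr (ltW v0)) mulVf // (gt_eqF v0).
Qed.

Let coefN_le : martingale_coef R N N <= 8 / r.
Proof.
have r0 : 0 < r by apply: lt_le_trans r_ge1.
rewrite ler_pdivlMr //; have := coefN_sqr; rewrite /limit_variance.
have := coef_ge0 R N N; set a := martingale_coef _ _ _ => a0 h.
(* [coefN_sqr] says that [(a * r) ^+ 2 = 637 / 12], which is below 64. *)
have : (a * r) ^+ 2 <= 8 ^+ 2 by lra.
by rewrite ler_pXn2r ?nnegrE // mulr_ge0 // ltW.
Qed.

Let coef_le j : (j <= N)%N ->
  [/\ martingale_coef R N j <= martingale_coef R N N, martingale_coef R N j <= 8 / r
    & martingale_coef R N j ^+ 2 <= 64 * j.+1%:R / r ^+ 4].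
Proof.
move=> jN; have r0 : 0 < r by apply: lt_le_trans r_ge1.
have jN' : j.+1%:R <= r ^+ 2 by rewrite r_sqr ler_nat.
have [||h1 h2] // := decay_bounds r0 jN' (coef_ge0 R N j) (coef_ge0 R N N) coefN_le.
  by rewrite r_sqr coef_decay //; lia.
by split=> //; apply: le_trans coefN_le.
Qed.

(** The subtracted term increases with [j] and reaches 1 at [N]; so the smoothing never
    degenerates. *)
Let residual_variance_ge j : (j <= N)%N -> e ^+ 2 <= residual_variance j.
Proof.
move=> jN; have [h1 _ _] := coef_le jN.
have jN' : j.+1%:R <= r ^+ 2 by rewrite r_sqr ler_nat.
rewrite /residual_variance addrAC lerDr subr_ge0 -[leRHS]coefN_sqr.
have c0 := ltW (limit_variance_gt0 R).
have := coef_ge0 R N j; have := coef_ge0 R N N; have := ler0n R j.+1.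
move: (martingale_coef R N j) (martingale_coef R N N) h1 (j.+1%:R) jN' => a b ab k kr k0 b0 a0.
apply: ler_pM; rewrite ?sqr_ge0 ?(mulr_ge0 c0 k0) ?(ler_wpM2l c0) //.
by rewrite lerXn2r ?nnegrE.
Qed.

Let residual_variance_step n : (4 < n)%N ->
  residual_variance n = residual_variance n.+1 +
    martingale_coef R N n.+1 ^+ 2 * (12 / 49 - 36 * limit_variance R / n.+1%:R).
Proof.
move=> n4; rewrite /residual_variance (coef_step R N n4) -[n.+2%:R]natr1 /limit_variance.
have : n.+1%:R != 0 :> R by rewrite pnatr_eq0.
by move: (martingale_coef _ _ _) n.+1%:R => a m m0; field.
Qed.

Let martingale_step n l : (4 < n)%N -> let p := 3 - 6 * l%:R / n.+1%:R in
  martingale n.+1 l = martingale n l - martingale_coef R N n.+1 * p /\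
  martingale n.+1 l.+1 = martingale n l + martingale_coef R N n.+1 * (1 - p).
Proof.
move=> n4 p; rewrite /p /martingale /centered (coef_step R N n4).
rewrite -[n.+2%:R]natr1 -[l.+1%:R]natr1.
have : n.+1%:R != 0 :> R by rewrite pnatr_eq0.
by move: (martingale_coef _ _ _) n.+1%:R l%:R => a m x m0; split; field.
Qed.

Variable K : R.
Hypothesis K0 : 0 < K.
Hypothesis stepK : forall t y a p v h : R, 0 <= p <= 1 -> 0 <= a -> 0 < v -> 0 <= h ->
  `|(1 - p) * Phi ((t - (y - a * p)) / Num.sqrt v)
    + p * Phi ((t - (y + a * (1 - p))) / Num.sqrt v)
    - Phi ((t - y) / Num.sqrt (v + h))|
  <= K * (`|a ^+ 2 * (p * (1 - p)) - h| / v + (a / Num.sqrt v) ^+ 3 + (h / v) ^+ 2).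

Let smoothed_step_pointwise n (pi : 'S_n.+1) (p : R := 3 - 6 * (Ln pi)%:R / n.+2%:R)
    (a := martingale_coef R N n.+2) : (4 < n.+1)%N -> (n.+1 < N)%N ->
  `|(1 - p) * smoothed n.+2 (Ln pi) + p * smoothed n.+2 (Ln pi).+1 - smoothed n.+1 (Ln pi)|
  <= K * (a ^+ 2 * (r^-1 + n.+2%:R^-1 + 2 * r * (6 / n.+2%:R * centered R n.+1 (Ln pi)) ^+ 2)
           / e ^+ 2 + (8 ^+ 3 / e ^+ 3 + 8 ^+ 4 / e ^+ 4) / r ^+ 3).
Proof.
move=> n4 nN.
have m0 : 0 < n.+2%:R :> R by rewrite ltr0n.
have [E1 E2] := martingale_step (Ln pi) n4.
have /andP[b1 b2] := Ln_bounds pi.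
have p01 : 0 <= p <= 1.
  have c1 : n.+2%:R <= 3 * (Ln pi)%:R :> R by rewrite -natrM ler_nat.
  have c2 : 2 * (Ln pi)%:R <= n.+2%:R :> R by rewrite -natrM ler_nat.
  have q1 : (Ln pi)%:R / n.+2%:R <= 1 / 2 :> R by rewrite ler_pdivrMr //; lra.
  have q2 : 1 / 3 <= (Ln pi)%:R / n.+2%:R :> R by rewrite ler_pdivlMr //; lra.
  have -> : p = 3 - 6 * ((Ln pi)%:R / n.+2%:R) by rewrite /p mulrA.
  by move: (_ / _) q1 q2 => q q1 q2; apply/andP; split; lra.
rewrite {1 2}/smoothed E1 E2 {E1 E2} /smoothed (residual_variance_step n4) -/p.
have [_ a8 _] := coef_le nN.
have ev := residual_variance_ge nN.
move: (martingale n.+1 (Ln pi)) => y.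
have a0 : 0 <= a by exact: coef_ge0.
rewrite -/a in a8 *; set h := a ^+ 2 * (12 / 49 - _).
have e2 : 0 < e ^+ 2 by rewrite exprn_gt0.
have v0 := lt_le_trans e2 ev.
(* This makes [h] nonnegative, as [36 * (12 / 637) / 6 < 12 / 49]. *)
have m6 : n.+2%:R^-1 <= 6^-1 :> R by rewrite lef_pV2 ?posrE ?ltr0n // ler_nat.
have mi : 0 <= n.+2%:R^-1 :> R by rewrite invr_ge0.
have h0 : 0 <= h <= a ^+ 2.
  have c0 : 0 <= 12 / 49 - 36 * limit_variance R / n.+2%:R <= 1.
    by rewrite /limit_variance; move: _^-1 m6 mi => k k6 k0; apply/andP; split; lra.
  have /andP[c1 c2] := c0.
  by rewrite mulr_ge0 ?sqr_ge0 //= ler_piMr ?sqr_ge0.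
apply: le_trans (stepK t y p01 a0 v0 (andP h0).1) _; rewrite ler_wpM2l ?(ltW K0) // -addrA.
apply: lerD; last exact: step_error_bound.
rewrite ler_pM // ?invr_ge0 ?(ltW v0) ?lef_pV2 //.
set z := 6 / _ * _.
have -> : p = 3 / 7 - z by rewrite /p /z /centered; field; rewrite gt_eqF.
exact: bernoulli_variance_error.
Qed.

Definition step_constant : R :=
  K * (64 * (1 + 2 * (1 + 2 * 432)) / e ^+ 2 + (8 ^+ 3 / e ^+ 3 + 8 ^+ 4 / e ^+ 4)).

Let smoothed_step n : (4 < n)%N -> (n < N)%N ->
  `|mean_Ln n.+1 (smoothed n.+1) - mean_Ln n (smoothed n)| <= step_constant / r ^+ 3.
Proof.
case: n => // n n4 nN; rewrite mean_Ln_step -mean_LnB.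
have r0 : 0 < r by apply: lt_le_trans r_ge1.
have m0 : 0 < n.+2%:R :> R by rewrite ltr0n.
apply: le_trans (ler_norm_mean_Ln _ _) _.
set a := martingale_coef R N n.+2; set D := (8 ^+ 3 / e ^+ 3 + 8 ^+ 4 / e ^+ 4) / r ^+ 3.
set m : R := n.+2%:R in m0 *.
apply: (@le_trans _ _ (mean_Ln n.+1 (fun l =>
  K * (a ^+ 2 * (r^-1 + m^-1 + 2 * r * (6 / m * centered R n.+1 l) ^+ 2) / e ^+ 2 + D)))).
  by apply: le_mean_Ln => pi; exact: smoothed_step_pointwise.
(* The pointwise bound is affine in the squared deviation, so averaging replaces that square by its
   mean [E]. *)
set E := 36 / m ^+ 2 * mean_Ln n.+1 (fun l => centered R n.+1 l ^+ 2).
apply: (@le_trans _ _ (K * (a ^+ 2 * (r^-1 + m^-1 + 2 * r * E) / e ^+ 2 + D))).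
  rewrite mean_LnZ mean_LnD mean_Ln_cst.
  rewrite (@eq_mean_Ln _ _ _ (fun l => a ^+ 2 * (r^-1 + m^-1) / e ^+ 2
      + a ^+ 2 * (2 * r * (36 / m ^+ 2)) / e ^+ 2 * centered R n.+1 l ^+ 2)).
    rewrite mean_LnD mean_Ln_cst mean_LnZ /E le_eqVlt; apply/orP; left; apply/eqP; ring.
  by move=> l; field; rewrite !gt_eqF.
have -> : step_constant / r ^+ 3 =
    K * (64 * (1 + 2 * (1 + 2 * 432)) / r ^+ 3 / e ^+ 2 + D).
  by rewrite /step_constant /D; ring.
rewrite ler_wpM2l ?(ltW K0) // lerD2r ler_wpM2r ?invr_ge0 ?sqr_ge0 //.
have [ _ a8 a2] := coef_le nN.
apply: (mean_step_error _ r_ge1 _ a8 (coef_ge0 R N n.+2) (ler0n R 432)).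
- by rewrite ler1n.
- by rewrite natr1.
(* The constant 432 is 36 times the 12 of [mean_Ln_sqr_centered]. *)
have -> : 432 / m = 36 / m ^+ 2 * (12 * m) by field; rewrite gt_eqF.
by rewrite ler_wpM2l ?mean_Ln_sqr_centered // divr_ge0 ?ler0n ?sqr_ge0.
Qed.

(** There are [N - 5 <= r ^+ 2] steps, each costing [step_constant / r ^+ 3]. At [N] the residual
    variance is [e ^+ 2]. *)
Lemma smoothed_telescope :
  `|mean_Ln N (fun l => Phi ((t - centered R N l / Num.sqrt (VLn R N)) / e))
    - Phi (t / Num.sqrt (1 + e ^+ 2))| <= step_constant / r.
Proof.
have r0 : 0 < r by apply: lt_le_trans r_ge1.
have s0 : 0 <= step_constant / r ^+ 3.
  by apply: le_trans (normr_ge0 _) (smoothed_step (n := 5) _ _) => //; lia.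
have tele j : (j + 5 <= N)%N -> `|mean_Ln (j + 5) (smoothed (j + 5)) - mean_Ln 5 (smoothed 5)|
    <= j%:R * (step_constant / r ^+ 3).
  elim: j => [|j IH] jN; first by rewrite subrr normr0 mul0r.
  rewrite -natr1 mulrDl mul1r.
  apply: le_trans (ler_distD (mean_Ln (j + 5) (smoothed (j + 5))) _ _) _.
  rewrite [leLHS]addrC; apply: lerD; first exact: IH (ltnW jN).
  exact: smoothed_step (leq_addl _ _) jN.
have -> : Phi (t / Num.sqrt (1 + e ^+ 2)) = mean_Ln 5 (smoothed 5).
  rewrite -[LHS](mean_Ln_cst (R := R) 5); apply: eq_mean_Ln => l.
  rewrite /smoothed /martingale /residual_variance (_ : martingale_coef R N 5 = 0).
    by rewrite !mul0r expr0n mul0r !subr0.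
  by rewrite /martingale_coef ffact_small // !mul0r.
have -> : mean_Ln N (fun l => Phi ((t - centered R N l / Num.sqrt (VLn R N)) / e)) =
    mean_Ln N (smoothed N).
  have Nd : (5 < N)%N by lia.
  apply: eq_mean_Ln => l; rewrite /smoothed /martingale /residual_variance.
  rewrite -r_sqr coefN_sqr addrAC subrr add0r sqrtr_sqr ger0_norm ?(ltW e0) //.
  by rewrite coef_diag // VLnE // /limit_variance [_^-1 * _]mulrC.
have := tele (N - 5)%N; rewrite subnK; last by lia.
move=> /(_ (leqnn _)) h; apply: le_trans h _.
have -> : step_constant / r = r ^+ 2 * (step_constant / r ^+ 3) by field; rewrite gt_eqF.
by rewrite ler_wpM2r // r_sqr ler_nat; lia.
Qed.

End Telescope.

(** * From the smoothed law to the distribution function *)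

Lemma cdf_normalized_LnE (R : realType) n (x : R) : (5 < n)%N ->
  cdf_normalized_Ln n x =
  mean_Ln n (fun l => (centered R n l / Num.sqrt (VLn R n) <= x)%R%:R).
Proof.
move=> n5; rewrite /cdf_normalized_Ln /mean_Ln ELnE // -sum1_card natr_sum big_mkcond /=.
by congr (_ / _); apply: eq_bigr => pi _; rewrite inE; case: ifP.
Qed.

Lemma smoothed_cdf_cvg (R : realType) (e : R) : 0 < e -> exists2 C : R, 0 < C &
  forall t N, (11 < N)%N ->
  `|mean_Ln N (fun l => Phi ((t - centered R N l / Num.sqrt (VLn R N)) / e))
    - Phi (t / Num.sqrt (1 + e ^+ 2))| <= C / Num.sqrt N.+1%:R.
Proof.
move=> e0; have [K K0 stepK] := Phi_bernoulli_step R.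
exists (step_constant e K) => [|t N N11]; last exact: smoothed_telescope.
have c0 : 0 < 64 * (1 + 2 * (1 + 2 * 432)) :> R by lra.
apply: (mulr_gt0 K0); apply: ltr_wpDr; last exact: divr_gt0 c0 (exprn_gt0 2 e0).
by rewrite addr_ge0 ?divr_ge0 ?exprn_ge0 ?ler0n ?(ltW e0).
Qed.

Lemma Phi_tails (R : realType) (d : R) : 0 < d ->
  exists2 k : R, 0 < k & Phi (- k) <= d /\ 1 - Phi k <= d.
Proof.
move=> d0.
have /cvgrPdist_le /(_ _ d0) [a [_ ha]] := @Phi_cvgNy R.
have /cvgrPdist_le /(_ _ d0) [b [_ hb]] := @Phi_cvgy R.
have na := ler_norm (- a); have nb := ler_norm b; rewrite normrN in na.
have a0 := normr_ge0 a; have b0 := normr_ge0 b.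
exists (`|a| + `|b| + 1); first by lra.
have /ha h1 : - (`|a| + `|b| + 1) < a by lra.
have /hb h2 : b < `|a| + `|b| + 1 by lra.
split; first by rewrite sub0r normrN ger0_norm ?Phi_ge0 in h1.
by rewrite ger0_norm ?subr_ge0 ?Phi_le1 in h2.
Qed.

(** As [1 <= Num.sqrt (1 + e ^+ 2) <= 1 + e], the rescaling moves [x] by at most [|x| * e] and does
    not enlarge [u]. *)
Lemma Phi_perturbation (R : realType) (L x u e : R) : 0 <= L ->
  (forall a b : R, `|Phi b - Phi a| <= L * `|b - a|) -> 0 < e ->
  `|Phi ((x + u) / Num.sqrt (1 + e ^+ 2)) - Phi x| <= L * (`|u| + `|x| * e).
Proof.
move=> L0 lip e0; apply: le_trans (lip _ _) _; rewrite ler_wpM2l //.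
have s1 : 1 <= Num.sqrt (1 + e ^+ 2) by rewrite -[leLHS]sqrtr1 ler_wsqrtr // lerDl sqr_ge0.
have se : Num.sqrt (1 + e ^+ 2) <= 1 + e.
  by rewrite -[leRHS]ger0_norm ?addr_ge0 ?(ltW e0) // -sqrtr_sqr ler_wsqrtr //; nra.
move: (Num.sqrt _) s1 se => s s1 se; have s0 : 0 < s by lra.
have -> : (x + u) / s - x = u / s + x * ((1 - s) / s) by field; rewrite gt_eqF.
apply: le_trans (ler_normD _ _) _; rewrite !normrM normfV (gtr0_norm s0).
apply: lerD; first by rewrite ler_pdivrMr // ler_peMr.
by rewrite ler_wpM2l // distrC ger0_norm ?subr_ge0 // ler_pdivrMr //; nra.
Qed.

(** Raising the threshold by [e * k] puts the argument of [Phi] at [k] or beyond when the indicator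
    is 1; the cost is one tail. *)
Lemma indicator_le_smooth (R : realType) (x w e k : R) : 0 < e ->
  (w <= x)%R%:R <= Phi ((x + e * k - w) / e) + (1 - Phi k).
Proof.
move=> e0; case: (leP w x) => xw /=; last first.
  by rewrite mulr0n addr_ge0 ?Phi_ge0 // subr_ge0 Phi_le1.
have : Phi k <= Phi ((x + e * k - w) / e).
  by apply: Phi_nondecreasing; rewrite ler_pdivlMr // mulrC; lra.
by rewrite mulr1n; lra.
Qed.

Lemma indicator_ge_smooth (R : realType) (x w e k : R) : 0 < e ->
  Phi ((x - e * k - w) / e) - Phi (- k) <= (w <= x)%R%:R.
Proof.
move=> e0; case: (leP w x) => xw /=.
  by rewrite mulr1n lerBlDr ler_wpDr ?Phi_ge0 ?Phi_le1.
by rewrite mulr0n subr_le0; apply: Phi_nondecreasing; rewrite ler_pdivrMr // mulrC; lra.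
Qed.

Unset Implicit Arguments.

Theorem theorem5p1 (R : realType) :
  (forall n : nat, (11 < n)%N ->
     ELn R n = 3%:R / 7%:R * (n.+1)%:R /\
     VLn R n = 12%:R / 637%:R * (n.+1)%:R) /\
  (forall x : R,
     ((fun n : nat => (@cdf_normalized_Ln R n x)%:E) @ \oo
        --> normal_prob (0 : R) 1 `]-oo, x])%E).
Proof.
split=> [n n11|x]; first by rewrite VLnE // ELnE //; lia.
rewrite PhiE; apply: cvg_EFin; first by apply: nearW.
apply/cvgrPdist_le => d d0.
have d4 : 0 < d / 4 by rewrite divr_gt0.
have [L L0 lip] := Phi_lipschitz R.
have [k k0 [tl tr]] := Phi_tails d4.
(* Chosen so that [L * (e * k + |x| * e + e) = d / 4]; the added 1 keeps room for a strict
   excess. *)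
pose e := d / 4 / (L * (k + `|x| + 1)).
have kx : 0 < k + `|x| + 1 by rewrite addr_gt0 // ltr_wpDr.
have e0 : 0 < e by rewrite divr_gt0 // mulr_gt0.
have shift (u : R) : `|u| = e * k ->
    `|Phi ((x + u) / Num.sqrt (1 + e ^+ 2)) - Phi x| <= d / 4.
  move=> hu; apply: le_trans (Phi_perturbation x u (ltW L0) lip e0) _.
  rewrite hu; have -> : d / 4 = L * (e * k + `|x| * e + e).
    by rewrite /e; field; rewrite !gt_eqF.
  by rewrite ler_wpM2l ?(ltW L0) // lerDl ltW.
have [C C0 smooth] := smoothed_cdf_cvg e0.
near=> n.
have n11 : (11 < n)%N by near: n; exists 12.
have small : C / Num.sqrt n.+1%:R <= d / 4.
  have h : (4 * C / d) ^+ 2 <= n.+1%:R.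
    rewrite -[n.+1%:R]natr1 ler_wpDr //.
    by near: n; exact: nbhs_infty_ger.
  have s0 : 0 < Num.sqrt (n.+1%:R : R) by rewrite sqrtr_gt0 ltr0n.
  have : 4 * C / d <= Num.sqrt n.+1%:R.
    rewrite -[leLHS]ger0_norm; last by rewrite divr_ge0 ?mulr_ge0 ?ler0n ?ltW.
    by rewrite -sqrtr_sqr ler_wsqrtr.
  by rewrite !ler_pdivrMr //; lra.
rewrite /= cdf_normalized_LnE; last exact: leq_trans n11.
have up : mean_Ln n (fun l => (centered R n l / Num.sqrt (VLn R n) <= x)%R%:R) <=
    mean_Ln n (fun l => Phi ((x + e * k - centered R n l / Num.sqrt (VLn R n)) / e))
    + (1 - Phi k).
  rewrite -[X in _ + X](mean_Ln_cst n) -mean_LnD.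
  by apply: le_mean_Ln => pi; exact: indicator_le_smooth.
have low : mean_Ln n (fun l => Phi ((x - e * k - centered R n l / Num.sqrt (VLn R n)) / e))
    - Phi (- k) <= mean_Ln n (fun l => (centered R n l / Num.sqrt (VLn R n) <= x)%R%:R).
  rewrite -[X in _ - X](mean_Ln_cst n) -mean_LnB.
  by apply: le_mean_Ln => pi; exact: indicator_ge_smooth.
have ek : 0 <= e * k by rewrite mulr_ge0 // ltW.
(* On each side three errors of at most [d / 4] add up: tail, smoothed limit theorem, and shift with
   rescaling. *)
have := smooth (x + e * k) n n11; have := smooth (x - e * k) n n11.
have := shift (e * k) (ger0_norm ek); have := shift (- (e * k)).
rewrite normrN (ger0_norm ek) => /(_ erefl).
move: up low; move: (mean_Ln _ _) (mean_Ln _ _) (mean_Ln _ _) => m1 m2 m3 up low.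
rewrite !ler_norml => /andP[? ?] /andP[? ?] /andP[? ?] /andP[? ?].
by apply/andP; split; lra.
Unshelve. all: by end_near. Qed.
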